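(* For any non-negative integer $k$: (1) there is a Bruhat interval $[v,w]$ (in some symmetric group $\mathfrak{S}_n$) that is a Boolean algebra and satisfies $c(v,w)=k$; (2) there is a toric Bruhat interval polytope $Q_{v,w}$ (for some $v\le w$ in some $\mathfrak{S}_n$) such that $d(v)=d(w)=\dim Q_{v,w}+k$; and (3) there is a toric Bruhat interval polytope $Q_{v,w}$ (for some $v\le w$ in some $\mathfrak{S}_n$) with $|d(v)-d(w)|=k$.
   Context: $\mathfrak{S}_n$ is the symmetric group on $\{1,\dots,n\}$, $\ell(\cdot)$ is the length with respect to the simple transpositions $s_i=(i,i+1)$, and $\le$ is Bruhat order. For $v\le w$, $[v,w]=\{z\in\mathfrak{S}_n\mid v\le z\le w\}$, and the Bruhat interval polytope $Q_{v,w}$ is the convex hull in $\mathbb{R}^n$ of the points $(z(1),\dots,z(n))$ for $z\in[v,w]$; each $u\in[v,w]$ is identified with the vertex $(u(1),\dots,u(n))$ of $Q_{v,w}$, and $d(u)$ denotes the number of edges of $Q_{v,w}$ meeting at that vertex. $Q_{v,w}$ is called toric if $\dim Q_{v,w}=\ell(w)-\ell(v)$. The complexity of $[v,w]$ is $c(v,w):=\ell(w)-\ell(v)-\dim Q_{v,w}$. A Boolean algebra is a poset isomorphic to the poset of all subsets of a finite set ordered by inclusion. *)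

(* Defs.v *)
From HB Require Import structures.
From mathcomp Require Import all_boot all_order all_algebra all_fingroup.
From mathcomp Require Import finmap.
From mathcomp Require Import boolp classical_sets cardinality reals convex.

Set Implicit Arguments.
Unset Strict Implicit.
Unset Printing Implicit Defensive.

Import Order.TTheory GRing.Theory Num.Theory.

Local Open Scope classical_set_scope.
Local Open Scope ring_scope.

Section BruhatOrder.
Variable n : nat.
Implicit Types u v w z : 'S_n.

Definition simple_transpositions : {set 'S_n} :=
  [set s | [exists i : 'I_n, exists j : 'I_n,
             (j == i.+1 :> nat) && (s == tperm i j)]]%SET.

Lemma simple_transpositions_gen w :
  exists l : nat, w \in (simple_transpositions ^+ l)%g.
Proof.
have adj_gen d (i j : 'I_n) : (j = i + d :> nat)%N ->
    tperm i j \in <<simple_transpositions>>%g.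
  elim: d i j => [|d IHd] i j eq_j.
    have -> : j = i by apply: val_inj; rewrite /= eq_j addn0.
    by rewrite tperm1 group1.
  have lt_m : (i + d < n)%N by rewrite (leq_trans _ (ltn_ord j)) // eq_j addnS.
  pose m := Ordinal lt_m.
  have im : tperm i m \in <<simple_transpositions>>%g by apply: IHd.
  have mj : tperm m j \in <<simple_transpositions>>%g.
    apply/mem_gen; rewrite inE; apply/existsP; exists m; apply/existsP; exists j.
    by rewrite eqxx andbT /= eq_j addnS.
  have [eq_mi|ne_mi] := eqVneq m i; first by rewrite -eq_mi.
  have ne_ij : i != j by rewrite -val_eqE /= eq_j addnS -addSn neq_ltn leq_addr.
  have ne_mj : m != j by rewrite -val_eqE /= eq_j addnS neq_ltn leqnn.
  suff -> : tperm i j = (tperm i m ^ tperm m j)%g by rewrite groupJ.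
  by rewrite tpermJ tpermL tpermD // eq_sym.
have wgen : w \in <<simple_transpositions>>%g.
  have [ts -> _] := prod_tpermP w.
  apply: group_prod => -[i j] _ /=.
  have [le_ij|/ltnW le_ji] := leqP i j.
    by apply: (adj_gen (j - i)%N); rewrite subnKC.
  by rewrite tpermC; apply: (adj_gen (i - j)%N); rewrite subnKC.
have [l [c cS ->]] := gen_prodgP wgen.
exists l; elim: l c cS => [|l IHl] c cS; first by rewrite big_ord0 expg0 set11.
by rewrite big_ord_recl expgS mem_mulg // IHl // => i; apply: cS.
Qed.

(* [A ^+ l] is the set of products of [l] elements of [A]. *)
Definition perm_length w : nat := ex_minn (simple_transpositions_gen w).

(* In mathcomp, [(u * t) i = t (u i)]; multiplying by transpositions on the
   other side gives the same relation, as [u * t = t ^ u^-1 * u]. *)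
Definition bruhat_step : rel 'S_n := fun u w =>
  [exists i : 'I_n, exists j : 'I_n, w == (u * tperm i j)%g]
  && (perm_length u < perm_length w)%N.

Definition bruhat : rel 'S_n := connect bruhat_step.

Definition bruhat_interval v w : {set 'S_n} :=
  [set z | bruhat v z && bruhat z w]%SET.

End BruhatOrder.

Definition boolean_algebra (T : finType) (le : rel T) (A : {set T}) : Prop :=
  exists (S : finType) (f : {set S} -> T),
    f @: [set: {set S}]%SET = A /\
    (forall X Y : {set S}, le (f X) (f Y) = (X \subset Y)).

Section Polytopes.
Variables (R : realType) (n : nat).
Implicit Types (P F : set 'rV[R]_n) (x : 'rV[R]_n).

Definition convex_hull (A : set 'rV[R]_n) : set 'rV[R]_n :=
  smallest (@convex_set R 'rV[R]_n) A.

(* One less than the largest number of affinely independent points of [P]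
   (and 0 if [P] is empty). *)
Definition affine_dim P : nat :=
  \max_(d < n.+1 |
      `[< exists (x : 'rV[R]_n) (D : 'M[R]_(d, n)),
            [/\ P x, forall i, P (x + row i D) & row_free D] >]) d.

Definition is_face P F : Prop :=
  exists (c : 'cV[R]_n) (b : R),
    (forall x, P x -> (x *m c) 0 0 <= b) /\
    F = P `&` [set x | (x *m c) 0 0 = b].

Definition edges_at P x : set (set 'rV[R]_n) :=
  [set F | [/\ is_face P F, affine_dim F = 1%N & F x]].

(* [fset_set A] is empty when [A] is infinite, but a polytope has finitely many
   faces. *)
Definition edge_degree P x : nat := #|` fset_set (edges_at P x)|%fset.

End Polytopes.

Section BruhatIntervalPolytope.
Variables (R : realType) (n : nat).
Implicit Types u v w : 'S_n.

(* Indices and values in ['I_n] start from 0, hence the successor. *)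
Definition perm_point u : 'rV[R]_n := \row_i (u i).+1%:R.

Definition bip v w : set 'rV[R]_n :=
  convex_hull [set perm_point z | z in [set z | z \in bruhat_interval v w]].

Definition bip_degree v w u : nat := edge_degree (bip v w) (perm_point u).

Definition complexity v w : int :=
  (perm_length w)%:Z - (perm_length v)%:Z - (affine_dim (bip v w))%:Z.

Definition toric v w : Prop :=
  (affine_dim (bip v w))%:Z = (perm_length w)%:Z - (perm_length v)%:Z.

End BruhatIntervalPolytope.

Arguments bip R {n} v w.
Arguments bip_degree R {n} v w u.
Arguments complexity R {n} v w.
Arguments toric R {n} v w.

(* Main.v *)
Require Import Defs.
From mathcomp Require Import all_boot all_order all_algebra all_fingroup.
From mathcomp Require Import finmap interval_inference boolp classical_sets cardinality.
From mathcomp Require Import reals convex.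
From mathcomp Require Import zify ring lra.

Set Implicit Arguments.
Unset Strict Implicit.
Unset Printing Implicit Defensive.

Import Order.TTheory GRing.Theory Num.Theory.

(** All three statements are additive over direct sums of permutations: for
    [v, w] in S_m, the k-fold direct sum of copies of v and of w lies in
    S_(km), its Bruhat interval is the k-th power of [v, w], its polytope is
    the k-th power of Q_{v,w}, and lengths, dimensions and the vertex degrees
    at constant sums are multiplied by k. It thus suffices to find one interval
    with defect 1 for each statement:
    - [1324, 4231] is a Boolean algebra of rank 4, and its polytope has
      dimension 3;
    - [1324, 3412] has length and dimension 3, with 4 edges at both ends;
    - [13254, 35142] has length and dimension 4, with 6 edges at the bottom
      and 5 at the top.

    Lengths and Bruhat order are handled through two facts. Twice the length
    of u is the number of ordered pairs of positions that u puts in the wrong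
    order ([perm_length_discord]), and any sum of f p (u p) over the positions
    p increases along Bruhat order as soon as creating an inversion never
    decreases it ([bruhat_statistic]). Counting entries in a corner of the
    permutation matrix gives the rank criterion inside each block, and shows
    that everything below a block permutation is a block permutation. So a
    Bruhat interval between block sums consists of the block sums of words
    satisfying the rank criterion ([block_interval]); the converse direction
    climbs one block at a time, along chains checked to exist in a single
    block.

    The degree of a vertex x is obtained from certificates
    ([edge_degree_hull]): a list of neighbours y_i, a linear form for each i
    whose maximum on the polytope is attained exactly at x and y_i among the
    generating points, and the fact that the y_i - x span the cone of the
    polytope at x. Certificates for a block combine into certificates for the
    sum ([edge_degree_block]). Dimensions are pinned between the number of
    independent directions ([affine_dim_block_ge]) and the dimension left by
    the constant coordinate sum of every block ([affine_dim_block_le]). What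
    remains is a finite verification on words of size 4 and 5. *)

(** * Length and Bruhat order *)
Section Length.
Variable n : nat.
Implicit Types (u w z : 'S_n) (a b c p q : 'I_n).

(** Inversions are counted over ordered pairs, hence twice: the indicator is
    then symmetric and vanishes on the diagonal, so exchanging two positions a
    and b affects only the terms that involve a or b. *)
Definition discordant u p q : bool := (p < q) (+) (u p < u q).

Definition discord u : nat := \sum_p \sum_q discordant u p q.

Lemma discordantC u p q : discordant u p q = discordant u q p.
Proof.
rewrite /discordant; have [->//|ne_pq] := eqVneq p q.
have ne_u : u p != u q by rewrite (inj_eq perm_inj).
move: ne_pq ne_u; rewrite -!val_eqE /=.
by case: (ltngtP p q) => // _ _; case: (ltngtP (u p) (u q)).
Qed.

Lemma discordant0 u p : discordant u p p = false.
Proof. by rewrite /discordant !ltnn. Qed.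

Lemma sum_two a b (F : 'I_n -> nat) : a != b ->
  \sum_p F p = F a + F b + \sum_(p | (p != a) && (p != b)) F p.
Proof. by move=> ne; rewrite (bigD1 a) //= (bigD1 b) 1?eq_sym //= addnA. Qed.

(** Isolates what an exchange of the values at a and b can change. *)
Lemma discord_two u a b : a != b ->
  discord u = \sum_(p | (p != a) && (p != b))
                 \sum_(q | (q != a) && (q != b)) discordant u p q
    + 2 * \sum_(p | (p != a) && (p != b)) (discordant u p a + discordant u p b)
    + 2 * discordant u a b.
Proof.
move=> ne; rewrite /discord (sum_two _ ne).
rewrite !(sum_two (fun q => nat_of_bool (discordant u _ q)) ne) !discordant0.
under [X in _ + X]eq_bigr => p _ do rewrite (sum_two _ ne).
rewrite [X in _ + X]big_split /= (discordantC u b a).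
under eq_bigr do rewrite discordantC.
under [X in _ + (_ + X) + _]eq_bigr do rewrite discordantC.
by rewrite [\sum_(p | _) (_ + _)]big_split /=; lia.
Qed.

Lemma tperm_mull u a b : (tperm a b * u)%g = (u * tperm (u a) (u b))%g.
Proof. by rewrite -tpermJ conjgE mulgA mulgA mulgV mul1g. Qed.

Section Swap.
Variables (u : 'S_n) (a b : 'I_n).
Let w := (tperm a b * u)%g.

Lemma swapL : w a = u b. Proof. by rewrite permM tpermL. Qed.
Lemma swapR : w b = u a. Proof. by rewrite permM tpermR. Qed.
Lemma swapD c : c != a -> c != b -> w c = u c.
Proof. by move=> ca cb; rewrite permM tpermD // eq_sym. Qed.

(** A third position c is never in the right order with more of a and b after
    the exchange than before, and the pair (a, b) itself becomes an
    inversion. *)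
Lemma discord_swap_lt : a < b -> u a < u b -> discord u < discord w.
Proof.
move=> lt_ab lt_u; have ne : a != b by rewrite -val_eqE /= ltn_eqF.
rewrite !(discord_two _ ne) -addnA -[ltnRHS]addnA.
rewrite (_ : \sum_(p | _) \sum_(q | _) _ = \sum_(p | (p != a) && (p != b))
   \sum_(q | (q != a) && (q != b)) discordant w p q); last first.
  apply: eq_bigr => p /andP[pa pb]; apply: eq_bigr => q /andP[qa qb].
  by rewrite /discordant !swapD.
rewrite ltn_add2l -!mulnDr ltn_pmul2l // -addnS leq_add //; last first.
  by rewrite /discordant swapL swapR lt_ab lt_u (ltnNge (u b)) (ltnW lt_u).
apply: leq_sum => c /andP[ca cb].
have : u c != u a by rewrite (inj_eq perm_inj).
have : u c != u b by rewrite (inj_eq perm_inj).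
move: ca cb; rewrite /discordant swapL swapR -!val_eqE /=.
move=> ca cb; rewrite swapD -?val_eqE // => ub ua.
by case: (ltngtP c a) ca => //; case: (ltngtP c b) cb => //;
  case: (ltngtP (u c) (u a)) ua => //; case: (ltngtP (u c) (u b)) ub => //; lia.
Qed.

(** When the two values are consecutive, no third value lies between them, so
    only the pair (a, b) changes status. *)
Lemma discord_swap_adj : u b = (u a).+1 :> nat ->
  discord w + 2 * (b < a) = discord u + 2 * (a < b).
Proof.
move=> ub; have ne : a != b by apply: contraPneq ub => ->; lia.
rewrite !(discord_two _ ne).
rewrite (_ : \sum_(p | _) \sum_(q | _) discordant w _ _ =
   \sum_(p | (p != a) && (p != b))
     \sum_(q | (q != a) && (q != b)) discordant u p q); last first.
  apply: eq_bigr => p /andP[pa pb]; apply: eq_bigr => q /andP[qa qb].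
  by rewrite /discordant !swapD.
rewrite (_ : \sum_(p | _) (discordant w _ _ + _) =
   \sum_(p | (p != a) && (p != b)) (discordant u p a + discordant u p b)).
  have -> : discordant w a b = (a < b) by rewrite /discordant swapL swapR; lia.
  have -> : discordant u a b = ~~ (a < b) by rewrite /discordant; lia.
  by move: ne; rewrite -val_eqE /=; case: (ltngtP a b) => //=; lia.
apply: eq_bigr => c /andP[ca cb]; rewrite /discordant swapL swapR (swapD ca cb).
have : u c != u a by rewrite (inj_eq perm_inj).
have : u c != u b by rewrite (inj_eq perm_inj).
by rewrite -!val_eqE /= ub; lia.
Qed.

End Swap.

Lemma discord_mul_adj u (i j : 'I_n) : j = i.+1 :> nat ->
  discord (u * tperm i j)%g + 2 * (u^-1%g j < u^-1%g i) =
  discord u + 2 * (u^-1%g i < u^-1%g j).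
Proof.
move=> ji; have := @discord_swap_adj u (u^-1 i)%g (u^-1 j)%g.
by rewrite tperm_mull !permKV => /(_ ji).
Qed.

Lemma discord_simple u s : s \in simple_transpositions n ->
  discord (u * s)%g <= discord u + 2.
Proof.
rewrite inE => /existsP[i /existsP[j /andP[/eqP ji /eqP ->]]].
apply: leq_trans (leq_addr (2 * (u^-1%g j < u^-1%g i)) _) _.
by rewrite (discord_mul_adj u ji) leq_add2l; case: (_ < _).
Qed.

Lemma discord_expg l w : w \in (simple_transpositions n ^+ l)%g -> discord w <= 2 * l.
Proof.
elim: l w => [|l IHl] w.
  rewrite expg0 => /set1P ->; rewrite /discord big1 // => p _.
  by rewrite big1 // => q _; rewrite /discordant !perm1 addbb.
rewrite expgSr => /mulsgP[u s /IHl ule sS ->].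
by apply: leq_trans (discord_simple u sS) _; rewrite mulnSr leq_add2r.
Qed.

Lemma increasing_id w : (forall i j : 'I_n, j = i.+1 :> nat -> w i < w j) -> w = 1%g.
Proof.
move=> inc.
have ge_id d (i : 'I_n) : i = d :> nat -> d <= w i.
  elim: d i => // d IHd i id; have lt_d : d < n by rewrite (leq_trans _ (ltn_ord i)) ?id.
  by apply: leq_ltn_trans (IHd (Ordinal lt_d) erefl) _; apply: inc.
have le_id d (i : 'I_n) : n = (i + d).+1 -> w i <= i.
  elim: d i => [|d IHd] i id; first by have := ltn_ord (w i); lia.
  have lt_i : i.+1 < n by lia.
  have := inc i (Ordinal lt_i) erefl; have := IHd (Ordinal lt_i).
  by rewrite /=; lia.
apply/permP => i; rewrite perm1; apply: val_inj; apply/eqP.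
by rewrite eqn_leq (@le_id (n - i.+1)) ?ge_id //=; have := ltn_ord i; lia.
Qed.

(** A simple transposition changes the number of inversions by one, which
    bounds the length from below; conversely a permutation other than the
    identity has a descent, and removing it shortens the permutation. *)
Lemma perm_length_discord w : 2 * perm_length w = discord w.
Proof.
rewrite /perm_length; case: ex_minnP => l wl minl; apply/eqP; rewrite eqn_leq.
rewrite (discord_expg wl) andbT.
suff [l' [wl' dl']] : exists l', w \in (simple_transpositions n ^+ l')%g /\ 2 * l' <= discord w.
  by apply: leq_trans dl'; rewrite leq_pmul2l // minl.
have [d] := ubnP (discord w); elim: d w {l wl minl} => // d IHd w; rewrite ltnS => le_d.
have [|/forallPn[i /forallPn[j]]] :=
  boolP [forall i : 'I_n, forall j : 'I_n, (j == i.+1 :> nat) ==> (w^-1%g i < w^-1%g j)].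
  move=> /forallP inc; exists 0; split=> //.
  rewrite (_ : w = 1%g) ?expg0 ?set11 //; apply: invg_inj; rewrite invg1.
  apply: increasing_id => i j /eqP ij.
  by move/forallP/(_ j)/implyP: (inc i); apply.
rewrite negb_imply -leqNgt => /andP[/eqP ji le_ji].
have := discord_mul_adj w ji.
have lt_ji : w^-1%g j < w^-1%g i.
  by rewrite ltn_neqAle le_ji andbT val_eqE (inj_eq perm_inj) -val_eqE /= ji; lia.
rewrite lt_ji (ltnNge (w^-1%g i)) (ltnW lt_ji) /= => dw.
have [|l [wl dl]] := IHd (w * tperm i j)%g; first by lia.
exists l.+1; split; last by lia.
rewrite expgSr -[w](mulgK (tperm i j)) tpermV mem_mulg // inE.
by apply/existsP; exists i; apply/existsP; exists j; rewrite ji !eqxx.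
Qed.

(** The length condition of a Bruhat step only fixes the direction of the
    exchange: exchanging an inverted pair would shorten the permutation. *)
Lemma bruhat_stepP u w :
  reflect (exists a b, [/\ a < b, u a < u b & w = tperm a b * u]%g)
          (bruhat_step u w).
Proof.
apply: (iffP andP) => [[/existsP[i /existsP[j /eqP ->]]]|[a [b [ab uab ->]]]]; last first.
  split; last by rewrite -(ltn_pmul2l (isT : 0 < 2)) !perm_length_discord discord_swap_lt.
  by apply/existsP; exists (u a); apply/existsP; exists (u b); rewrite tperm_mull.
rewrite -(ltn_pmul2l (isT : 0 < 2)) !perm_length_discord.
rewrite -(permKV u i) -(permKV u j) -tperm_mull.
move: (u^-1%g i) (u^-1%g j) => {i j} a b.
wlog lt_ab : a b / a < b.
  have [ab|ba|ab] := ltngtP a b => W lt; first exact: W.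
    by have [|a' [b' []]] := W b a ba; [rewrite tpermC | exists a', b'; rewrite tpermC].
  by move: lt; rewrite (val_inj ab) tperm1 mul1g ltnn.
move=> lt_d; exists a, b; split=> //; rewrite ltnNge; apply/negP => le_u.
have lt_u : (tperm a b * u)%g a < (tperm a b * u)%g b.
  rewrite swapL swapR ltn_neqAle le_u andbT val_eqE (inj_eq perm_inj).
  by rewrite -val_eqE /=; lia.
have := discord_swap_lt lt_ab lt_u; rewrite mulgA tperm2 mul1g.
by move/(ltn_trans lt_d); rewrite ltnn.
Qed.

Definition statistic (f : nat -> nat -> nat) w : nat := \sum_(p < n) f p (w p).

(** The shape condition on f for which turning a noninversion into an inversion
    does not decrease the sum of the f p (u p). *)
Definition exchange_increasing (f : nat -> nat -> nat) :=
  forall a b c d : nat, a < b -> c < d -> f a c + f b d <= f a d + f b c.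

Lemma bruhat_statistic (f : nat -> nat -> nat) u w :
  exchange_increasing f ->
  bruhat u w -> statistic f u <= statistic f w.
Proof.
move=> f_exch /connectP[s us ->] {w}; elim: s u us => //= w s IHs u /andP[uw ws].
apply: leq_trans (IHs w ws) => {IHs ws}.
have [a [b [ab uab ->]]] := bruhat_stepP _ _ uw.
have ne : a != b by rewrite -val_eqE /= ltn_eqF.
rewrite /statistic !(sum_two _ ne) swapL swapR leq_add ?f_exch //.
by apply: leq_sum => c /andP[ca cb]; rewrite swapD.
Qed.

End Length.

(** * Dimension and edges of a polytope *)
Section AffineDim.
Local Open Scope classical_set_scope.
Local Open Scope ring_scope.
Variables (R : realType) (n : nat).
Implicit Types (P F : set 'rV[R]_n) (x : 'rV[R]_n).

Lemma affine_dim_ge P d x (D : 'M[R]_(d, n)) :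
  P x -> (forall i, P (x + row i D)) -> row_free D -> (d <= affine_dim P)%N.
Proof.
move=> Px PD freeD; have le_dn : (d < n.+1)%N by rewrite ltnS -(eqP freeD) rank_leq_col.
rewrite /affine_dim (@leq_bigmax_cond _ _ (fun d : 'I_n.+1 => d : nat) (Ordinal le_dn)) //.
by apply/asboolP; exists x, D.
Qed.

Lemma affine_dim_le P x0 r (M : 'M[R]_(r, n)) :
  (forall x, P x -> (x - x0 <= M)%MS) -> (affine_dim P <= \rank M)%N.
Proof.
move=> PM; apply/bigmax_leqP => d /asboolP[x [D [Px PD freeD]]].
rewrite -(eqP freeD) mxrankS //; apply/row_subP => i.
have -> : row i D = (x + row i D - x0) + (-1) *: (x - x0).
  by rewrite scaleN1r opprB addrA subrK addrC addKr.
by rewrite addmx_sub ?scalemx_sub ?PM.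
Qed.

Lemma affine_dim_witness P : P !=set0 -> exists x (D : 'M[R]_(affine_dim P, n)),
  [/\ P x, forall i, P (x + row i D) & row_free D].
Proof.
move=> [p Pp]; rewrite /affine_dim.
have P0 : `[< exists x (D : 'M[R]_(ord0 : 'I_n.+1, n)),
    [/\ P x, forall i, P (x + row i D) & row_free D] >].
  by apply/asboolP; exists p, 0; split=> //; [case | rewrite /row_free mxrank0].
by rewrite (bigop.bigmax_eq_arg _ P0); case: arg_maxnP => // d /asboolP.
Qed.

End AffineDim.

Lemma nonpos_sum_eq0 (R : numDomainType) (J : finType) (f : J -> R) :
  (forall j, f j <= 0)%R -> (\sum_j f j = 0)%R -> forall j, f j = 0%R.
Proof.
move=> f_le0 f0 j; apply/eqP; rewrite -oppr_eq0; apply/eqP.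
apply: (psumr_eq0P (P := xpredT) (F := fun j => - f j)%R) => // [j' _|].
  by rewrite oppr_ge0.
by rewrite sumrN f0 oppr0.
Qed.

Section Hull.
Local Open Scope classical_set_scope.
Local Open Scope ring_scope.
Variables (R : realType) (n : nat) (T : finType) (A : {set T}) (pt : T -> 'rV[R]_n).
Let P := convex_hull [set pt z | z in [set z | z \in A]].

(** Makes the convex structure on row vectors explicit, which rewriting cannot
    see through the alias that carries it. *)
Lemma conv_lmodE (t : {i01 R}) (x y : 'rV[R]_n) :
  conv t (x : convex_lmodType 'rV[R]_n) y = t%:num *: x + (1 - t%:num) *: y.
Proof. by []. Qed.

Lemma hull_pt z : z \in A -> P (pt z).
Proof. by move=> zA C [_ subC]; apply: subC; exists z. Qed.

Definition combination (p : 'rV[R]_n) := exists l : T -> R,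
  [/\ forall z, 0 <= l z, forall z, z \notin A -> l z = 0,
      \sum_z l z = 1 & p = \sum_z l z *: pt z].

Lemma hull_combination p : P p -> combination p.
Proof.
apply: smallest_sub => [|_ [z zA <-]]; last first.
  exists (fun z' => (z' == z)%:R); split=> [z'|z' z'A||].
  - exact: ler0n.
  - by case: eqP z'A zA => // -> /negP.
  - by rewrite (bigD1 z) //= eqxx big1 ?addr0 // => i /negPf ->.
  - by rewrite (bigD1 z) //= eqxx big1 ?addr0 ?scale1r // => i /negPf ->; rewrite scale0r.
move=> x y t; rewrite !inE => -[l [l0 lA l1 ->]] [m [m0 mA m1 ->]].
exists (fun z => t%:num * l z + (1 - t%:num) * m z); split=> [z|z zA||].
- by rewrite addr_ge0 // mulr_ge0 // subr_ge0.
- by rewrite lA // mA // !mulr0 addr0.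
- by rewrite big_split /= -!mulr_sumr l1 m1 !mulr1 addrC subrK.
- rewrite conv_lmodE !scaler_sumr -big_split /=; apply: (@eq_bigr 'rV[R]_n) => z _.
  by rewrite [RHS]scalerDl !scalerA.
Qed.

Lemma combination_sub p x : combination p -> exists l : T -> R,
  [/\ forall z, 0 <= l z, forall z, z \notin A -> l z = 0, \sum_z l z = 1
   & p - x = \sum_z l z *: (pt z - x)].
Proof.
case=> l [l0 lA l1 ->]; exists l; split=> //.
under [RHS]eq_bigr do rewrite scalerBr.
by rewrite sumrB -scaler_suml l1 scale1r.
Qed.

Lemma hull_sub r (M : 'M[R]_(r, n)) x :
  (forall z, z \in A -> (pt z - x <= M)%MS) -> forall p, P p -> (p - x <= M)%MS.
Proof.
move=> AM p /hull_combination/(combination_sub x)[l [_ lA _ ->]].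
apply: summx_sub => z _; have [zA|zA] := boolP (z \in A).
  by apply: scalemx_sub; apply: AM.
by rewrite lA // scale0r sub0mx.
Qed.

Lemma mulBE (p q : 'rV[R]_n) (e : 'cV[R]_n) :
  ((p - q) *m e) 0 0 = (p *m e) 0 0 - (q *m e) 0 0.
Proof. by rewrite mulmxBl !mxE. Qed.

Lemma mul_sumE (J : finType) (l : J -> R) (d : J -> 'rV[R]_n) (e : 'cV[R]_n) :
  ((\sum_j l j *: d j) *m e) 0 0 = \sum_j l j * (d j *m e) 0 0.
Proof. by rewrite mulmx_suml summxE; apply: eq_bigr => j _; rewrite -scalemxAl mxE. Qed.

(** The face on which a linear form attains its maximum is generated by the
    points at which the form is maximal: the other ones get weight 0, because
    a sum of nonpositive terms vanishes only termwise. *)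
Lemma hull_face x (e : 'cV[R]_n) p :
  (forall z, z \in A -> ((pt z - x) *m e) 0 0 <= 0) ->
  P p -> ((p - x) *m e) 0 0 = 0 -> exists l : T -> R,
  [/\ forall z, 0 <= l z,
      forall z, l z != 0 -> z \in A /\ ((pt z - x) *m e) 0 0 = 0
    & p - x = \sum_z l z *: (pt z - x)].
Proof.
move=> e_le0 /hull_combination/(combination_sub x)[l [l0 lA _ pE]] pe.
exists l; split=> // z lz; have zA : z \in A by apply: contraNT lz => /lA ->.
split=> //; move: pe; rewrite pE mul_sumE => /nonpos_sum_eq0-/(_ _ z)/eqP.
rewrite mulf_eq0 (negPf lz) => /(_ _)/eqP; apply=> z'.
have [z'A|/lA ->] := boolP (z' \in A); last by rewrite mul0r.
by rewrite mulr_ge0_le0 ?e_le0.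
Qed.

Section Edges.
Variables (x : T) (I : finType) (y : I -> T) (c : I -> 'cV[R]_n).
Hypothesis xA : x \in A.
Hypothesis yA : forall i, y i \in A.
Hypothesis y_inj : injective y.
Hypothesis y_neq : forall i, pt (y i) != pt x.
Hypothesis c_le0 : forall i z, z \in A -> ((pt z - pt x) *m c i) 0 0 <= 0.
Hypothesis c_eq0 : forall i z, z \in A ->
  ((pt z - pt x) *m c i) 0 0 = 0 <-> z = x \/ z = y i.
Hypothesis cone : forall z, z \in A -> exists a : I -> R,
  (forall i, 0 <= a i) /\ pt z - pt x = \sum_i a i *: (pt (y i) - pt x).

Let edge i : set 'rV[R]_n := P `&` [set p | (p *m c i) 0 0 = (pt x *m c i) 0 0].

Let P_le i p : P p -> (p *m c i) 0 0 <= (pt x *m c i) 0 0.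
Proof.
move=> /hull_combination/(combination_sub (pt x))[l [l0 lA _ pE]].
rewrite -subr_le0 -mulBE pE mul_sumE sumr_le0 // => z _.
have [zA|zA] := boolP (z \in A); first by rewrite mulr_ge0_le0 ?c_le0.
by rewrite lA // mul0r.
Qed.

Let edge_line i p : edge i p -> exists t, p = pt x + t *: (pt (y i) - pt x).
Proof.
move=> [Pp /= pc]; have [|l [_ lA pE]] := hull_face (c_le0 i) Pp.
  by rewrite mulBE pc subrr.
exists (l (y i)); apply/eqP; rewrite addrC -subr_eq pE; apply/eqP.
rewrite (bigD1 (y i)) //= [X in _ + X]big1 ?addr0 // => z z_y.
have [->|/lA[zA]] := eqVneq (l z) 0; first by rewrite scale0r.
by case/(c_eq0 _ zA) => [->|eq_z]; [rewrite subrr scaler0 | rewrite eq_z eqxx in z_y].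
Qed.

Let edge_x i : edge i (pt x).
Proof. by split=> //; apply: hull_pt. Qed.

Let edge_y i : edge i (pt (y i)).
Proof.
split; first exact: hull_pt.
by apply/eqP; rewrite -subr_eq0 -mulBE; apply/eqP/c_eq0; [apply: yA | right].
Qed.

Let row_free1 (d : 'rV[R]_n) : d != 0 -> row_free d.
Proof. by move=> d0; rewrite /row_free rank_rV d0. Qed.

Let edge_dim i : affine_dim (edge i) = 1%N.
Proof.
apply/eqP; rewrite eqn_leq; apply/andP; split.
  apply: leq_trans (rank_leq_row (pt (y i) - pt x)).
  apply: (@affine_dim_le _ _ _ (pt x)) => p /edge_line[t ->].
  by rewrite addrC addKr scalemx_sub.
apply: (@affine_dim_ge _ _ _ _ (pt x) (pt (y i) - pt x)).
- exact: edge_x.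
- by move=> j; rewrite (ord1 j) row_id addrC subrK.
- by rewrite row_free1 // subr_eq0.
Qed.

Let edges_edge i : edges_at P (pt x) (edge i).
Proof.
split; [|exact: edge_dim|exact: edge_x].
by exists (c i), ((pt x *m c i) 0 0); split=> // p /P_le.
Qed.

Let edge_of F : edges_at P (pt x) F -> exists i, F = edge i.
Proof.
move=> [[e [b [e_le FE]] dimF Fx]].
have Fp p : F p <-> P p /\ (p *m e) 0 0 = b by rewrite FE.
have [_ xb] := (Fp _).1 Fx.
have [p Fpp p_x] : exists2 p, F p & p != pt x.
  have [q [D [Fq FD freeD]]] := affine_dim_witness (ex_intro _ _ Fx).
  rewrite dimF in D FD freeD.
  have [q_x|] := eqVneq q (pt x); last by exists q.
  exists (q + row 0 D); first exact: FD.
  apply: contraTneq freeD => /eqP; rewrite q_x addrC -subr_eq0 addrK row_id => /eqP ->.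
  by rewrite /row_free mxrank0.
have [Pp pb] := (Fp _).1 Fpp.
have e_z z : z \in A -> ((pt z - pt x) *m e) 0 0 <= 0.
  by move=> zA; rewrite mulBE xb subr_le0 e_le //; apply: hull_pt.
have [|l [_ lA pE]] := hull_face e_z Pp; first by rewrite mulBE pb xb subrr.
have [z [zA e0] z_x] : exists2 z, z \in A /\ ((pt z - pt x) *m e) 0 0 = 0 & pt z - pt x != 0.
  have : p - pt x != 0 by rewrite subr_eq0.
  apply: contra_neqP => no_z; rewrite pE big1 // => z _.
  have [->|/lA zA] := eqVneq (l z) 0; first by rewrite scale0r.
  have [->|z_x] := eqVneq (pt z - pt x) 0; first by rewrite scaler0.
  by case: no_z; exists z.
(* A positive combination of nonpositive numbers vanishes termwise, so the
   hyperplane contains the neighbours that have a nonzero coefficient. *)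
have [a [a0 zE]] := cone zA.
have [i ei] : exists i, ((pt (y i) - pt x) *m e) 0 0 = 0.
  apply: contra_neqP z_x => no_i; rewrite zE big1 // => i _.
  move: e0; rewrite zE mul_sumE => /nonpos_sum_eq0-/(_ _ i)/eqP.
  rewrite mulf_eq0 => /(_ _)/orP[j|/eqP ->|/eqP ei]; last by case: no_i; exists i.
    by rewrite mulr_ge0_le0 ?e_z.
  by rewrite scale0r.
exists i; apply/seteqP; split=> q.
  move=> Fq; suff /sub_rVP[t qE] : (q - pt x <= pt (y i) - pt x)%MS.
    split; first by have [] := (Fp _).1 Fq.
    apply/eqP; rewrite /= -subr_eq0 -mulBE qE -scalemxAl mxE mulBE.
    by have [_ ->] := edge_y i; rewrite subrr mulr0.
  apply: contraT => free2.
  have Fy : F (pt (y i)).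
    by apply/Fp; split; [apply: hull_pt | apply/eqP; rewrite -xb -subr_eq0 -mulBE ei].
  pose D := col_mx (pt (y i) - pt x) (q - pt x).
  have lt_D : (pt (y i) - pt x < D)%MS.
    rewrite ltmxE -!addsmxE addsmxSl /=; apply: contra free2.
    by apply: submx_trans; apply: addsmxSr.
  have freeD : row_free D.
    rewrite /row_free eqn_leq rank_leq_row /=.
    by have := rank_ltmx lt_D; rewrite rank_rV subr_eq0 y_neq.
  have := affine_dim_ge Fx _ freeD; rewrite dimF; apply=> j.
  rewrite -[j]splitK; case: (split j) => j' /=; rewrite ?rowKu ?rowKd (ord1 j') row_id.
    by rewrite addrC subrK.
  by rewrite addrC subrK.
move=> edge_q; have [t qE] := edge_line edge_q.
apply/Fp; split; first by case: edge_q.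
by apply/eqP; rewrite -xb -subr_eq0 -mulBE qE addrC addKr -scalemxAl mxE ei mulr0 eqxx.
Qed.

Let edge_inj : injective edge.
Proof.
move=> i j eq_ij; have : edge j (pt (y i)) by rewrite -eq_ij; apply: edge_y.
case=> _ /= yc.
have /c_eq0 : ((pt (y i) - pt x) *m c j) 0 0 = 0 by rewrite mulBE yc subrr.
case=> [|y_x|/y_inj //]; first exact: yA.
by have := y_neq i; rewrite y_x eqxx.
Qed.

(** The forms c i exhibit the segments from x to y i as edges. Conversely,
    an edge at x is cut out by a form that vanishes on some nonzero vector of
    the cone at x, hence on one of its generators y i - x; being
    one-dimensional, the edge coincides with the segment to y i. *)
Lemma edge_degree_hull : edge_degree P (pt x) = #|I|.
Proof.
rewrite /edge_degree (_ : edges_at _ _ = [set` [fset edge i | i in I]%fset]).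
  by rewrite set_fsetK card_imfset //= -cardE.
apply/seteqP; split=> [F /edge_of[i ->]|F /imfsetP[i _ ->]]; last exact: edges_edge.
by rewrite /= in_imfset.
Qed.

End Edges.
End Hull.

(** * Words and block sums *)
Notation entry := (nth 0).

Lemma sum_blocks (S : Type) (idx : S) (op : Monoid.law idx) k m (f : nat -> S) :
  \big[op/idx]_(p < k * m) f p =
  \big[op/idx]_(q < k) \big[op/idx]_(0 <= r < m) f (q * m + r).
Proof.
rewrite -(big_mkord xpredT f) -(big_mkord xpredT (fun q => \big[op/idx]_(0 <= r < m) f (q * m + r))).
rewrite big_nat_mul; apply: eq_big_nat => q _.
by rewrite -{1}[q * m]add0n big_addn mulSn addnK; apply: eq_bigr => r _; rewrite addnC.
Qed.

Section Word.
Variable m : nat.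
Implicit Types a b : seq nat.

(** A permutation of a single block, written as the list of its values from 0
    to m - 1, so that statements about blocks can be decided by evaluation. *)
Definition word a := perm_eq a (iota 0 m).

Lemma word_size a : word a -> size a = m.
Proof. by move=> /perm_size ->; rewrite size_iota. Qed.

Lemma word_lt a r : word a -> r < m -> entry a r < m.
Proof.
move=> wa lt_r; have := mem_nth 0 (_ : r < size a); rewrite word_size // => /(_ lt_r).
by rewrite (perm_mem wa) mem_iota.
Qed.

Lemma word_inj a r s : word a -> r < m -> s < m -> entry a r = entry a s -> r = s.
Proof.
move=> wa lt_r lt_s /eqP; rewrite nth_uniq ?word_size // => [/eqP //|].
by rewrite (perm_uniq wa) iota_uniq.
Qed.

Lemma eq_word a b : word a -> word b -> (forall r, r < m -> entry a r = entry b r) -> a = b.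
Proof.
move=> wa wb eq_ab; apply: (@eq_from_nth _ 0); first by rewrite !word_size.
by move=> r; rewrite word_size //; apply: eq_ab.
Qed.

Definition large_entries a x y : nat :=
  count (fun r => (r < x) && (y <= entry a r)) (index_iota 0 m).

(** The rank criterion for Bruhat order. *)
Definition word_le a b :=
  all (fun x => all (fun y => large_entries a x y <= large_entries b x y) (iota 0 m.+1))
      (iota 0 m.+1).

Definition word_discord a : nat :=
  sumn [seq sumn [seq nat_of_bool ((r < s) (+) (entry a r < entry a s)) | s <- index_iota 0 m]
       | r <- index_iota 0 m].

Definition swap_word a r s : seq nat :=
  [seq entry a (if t == r then s else if t == s then r else t) | t <- iota 0 m].

Definition word_step a b :=
  has (fun r => has (fun s => [&& r < s, entry a r < entry a s & b == swap_word a r s])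
    (iota 0 m)) (iota 0 m).

End Word.

Section BlockSum.
Variables k m : nat.
Implicit Types (F G : nat -> seq nat) (p : 'I_(k * m)).

(** Position q * m + r is sent to q * m + (F q)_r, that is, the words F q are
    placed along the diagonal. The list F is a function on all of nat, of which
    only the first k values matter; this avoids bounded indices. *)
Definition block_fun F : {ffun 'I_(k * m) -> 'I_(k * m)} :=
  [ffun p : 'I_(k * m) => insubd p (p %/ m * m + entry (F (p %/ m)) (p %% m))].

Definition block_sum F : 'S_(k * m) :=
  odflt (1%g : {perm 'I_(k * m)}) (insub (block_fun F)).

Lemma block_lt q r : q < k -> r < m -> q * m + r < k * m.
Proof. nia. Qed.

Lemma block_size_gt0 p : 0 < m.
Proof. by case: m p => // [[i]]; rewrite muln0. Qed.

Lemma block_index_lt p : p %/ m < k.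
Proof. by rewrite ltn_divLR ?(block_size_gt0 p). Qed.

Lemma block_offset_lt p : p %% m < m.
Proof. by rewrite ltn_mod (block_size_gt0 p). Qed.

Lemma block_div q r : r < m -> (q * m + r) %/ m = q.
Proof. by move=> r_m; rewrite divnMDl ?divn_small ?addn0 //; lia. Qed.

Lemma block_mod q r : r < m -> (q * m + r) %% m = r.
Proof. by move=> r_m; rewrite modnMDl modn_small. Qed.

Lemma block_sumE F p : (forall q, word m (F q)) ->
  block_sum F p = p %/ m * m + entry (F (p %/ m)) (p %% m) :> nat.
Proof.
move=> wF.
have lt_p (p' : 'I_(k * m)) : p' %/ m * m + entry (F (p' %/ m)) (p' %% m) < k * m.
  by rewrite block_lt ?word_lt ?block_offset_lt ?block_index_lt.
have inj : injectiveb [ffun p : 'I_(k * m) =>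
    insubd p (p %/ m * m + entry (F (p %/ m)) (p %% m))].
  apply/injectiveP => p1 p2; rewrite !ffunE => /(congr1 val).
  rewrite !val_insubd !lt_p => E.
  have eq_q := congr1 (divn^~ m) E; have eq_r := congr1 (modn^~ m) E.
  rewrite /= !block_div ?word_lt ?block_offset_lt // in eq_q.
  rewrite /= !block_mod ?word_lt ?block_offset_lt // eq_q in eq_r.
  apply: val_inj; rewrite /= (divn_eq p1 m) (divn_eq p2 m) eq_q.
  by rewrite (word_inj (wF _) _ _ eq_r) ?block_offset_lt.
rewrite /block_sum; case: insubP => [u _ uE|]; last by rewrite inj.
by rewrite /= -pvalE uE ffunE val_insubd lt_p.
Qed.

Lemma block_sum_at F q r (lt_qr : q * m + r < k * m) : (forall q, word m (F q)) ->
  r < m -> block_sum F (Ordinal lt_qr) = q * m + entry (F q) r :> nat.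
Proof. by move=> wF r_m; rewrite block_sumE //= block_div ?block_mod. Qed.

Lemma eq_block_sum F G : (forall q, q < k -> F q = G q) -> block_sum F = block_sum G.
Proof.
move=> eqFG; rewrite /block_sum; congr (odflt _ (insub _)).
by apply/ffunP => p; rewrite !ffunE eqFG ?block_index_lt.
Qed.

Lemma block_sum_inj F G : (forall q, word m (F q)) -> (forall q, word m (G q)) ->
  block_sum F = block_sum G -> forall q, q < k -> F q = G q.
Proof.
move=> wF wG eqFG q lt_q; apply: (eq_word (wF q) (wG q)) => r lt_r.
have := congr1 (fun u : 'S_(k * m) => val (u (Ordinal (block_lt lt_q lt_r)))) eqFG.
by rewrite /= !block_sum_at //; lia.
Qed.

Lemma discord_block_sum F : (forall q, word m (F q)) ->
  discord (block_sum F) = \sum_(q < k) word_discord m (F q).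
Proof.
move=> wF; pose g (p p' : nat) := nat_of_bool ((p < p')%N (+)
  (p %/ m * m + entry (F (p %/ m)) (p %% m) < p' %/ m * m + entry (F (p' %/ m)) (p' %% m))).
transitivity (\sum_(p < k * m) \sum_(p' < k * m) g p p').
  by apply: eq_bigr => p _; apply: eq_bigr => p' _; rewrite /discordant !block_sumE.
rewrite (sum_blocks _ _ _ (fun p : nat => \sum_(p' < k * m) g p p')); apply: eq_bigr => q _.
rewrite /word_discord sumnE big_map; apply: eq_big_nat => r /andP[_ r_m].
rewrite (sum_blocks _ _ _ (g _)) (bigD1 q) //= [X in _ + X]big1 ?addn0 => [|q' ne].
  rewrite sumnE big_map; apply: eq_big_nat => s /andP[_ s_m].
  by rewrite /g !block_div ?block_mod // !ltn_add2l.
rewrite big_nat big1 // => s /andP[_ s_m].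
rewrite /g !block_div ?block_mod //.
have := word_lt (wF q) r_m; have := word_lt (wF q') s_m.
move: ne; rewrite -val_eqE /=; move: (entry _ _) (entry _ _) => x y.
by case: (ltngtP q' q) => // lt_q _ lt_x lt_y; nia.
Qed.

Lemma perm_length_block_sum F : (forall q, word m (F q)) ->
  2 * perm_length (block_sum F) = \sum_(q < k) word_discord m (F q).
Proof. by move=> wF; rewrite perm_length_discord discord_block_sum. Qed.

(** The corner of the permutation matrix with its apex inside block q: outside
    of that block, a block sum has no entry in it. *)
Definition corner (q x y p P : nat) : nat := (p < q * m + x) && (q * m + y <= P).

Lemma corner_exchange q x y : exchange_increasing (corner q x y).
Proof. by move=> a b c d; rewrite /corner; lia. Qed.

Lemma statistic_block_sum F q x y : (forall q, word m (F q)) -> q < k -> x <= m ->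
  statistic (corner q x y) (block_sum F) = large_entries m (F q) x y.
Proof.
move=> wF lt_q le_x; rewrite /statistic.
pose g (p : nat) := corner q x y p (p %/ m * m + entry (F (p %/ m)) (p %% m)).
transitivity (\sum_(p < k * m) g p); first by apply: eq_bigr => p _; rewrite block_sumE.
rewrite (sum_blocks _ _ _ g) (bigD1 (Ordinal lt_q)) //= [X in _ + X]big1 ?addn0.
  rewrite /large_entries -sum1_count [RHS]big_mkcond; apply: eq_big_nat => r /andP[_ r_m].
  by rewrite /g /corner block_div ?block_mod // ltn_add2l leq_add2l; case: ifP.
move=> q' ne; rewrite big_nat big1 // => r /andP[_ r_m].
rewrite /g block_div ?block_mod // /corner.
have := word_lt (wF q') r_m; move: ne; rewrite -val_eqE /=; move: (entry _ _) => e.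
by case: (ltngtP q' q) => // lt_q' _ lt_e; nia.
Qed.

(** The necessity of the rank criterion, applied to the corners located in one
    block. *)
Lemma bruhat_word_le F G : (forall q, word m (F q)) -> (forall q, word m (G q)) ->
  bruhat (block_sum F) (block_sum G) -> forall q, q < k -> word_le m (F q) (G q).
Proof.
move=> wF wG leFG q lt_q; apply/allP => x; rewrite mem_iota => lt_x.
apply/allP => y _; rewrite -!statistic_block_sum //; try lia.
by apply: bruhat_statistic => //; apply: corner_exchange.
Qed.

Definition update (T : Type) (F : nat -> T) (q : nat) (a : T) (q' : nat) :=
  if q' == q then a else F q'.

Lemma bruhat_step_update F q a : (forall q, word m (F q)) -> word m a -> q < k ->
  word_step m (F q) a -> bruhat_step (block_sum F) (block_sum (update F q a)).
Proof.
move=> wF wa lt_q /hasP[r]; rewrite mem_iota => /= lt_r /hasP[s].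
rewrite mem_iota => /= lt_s /and3P[lt_rs lt_Frs /eqP aE].
have wU q' : word m (update F q a q') by rewrite /update; case: ifP.
apply/bruhat_stepP; exists (Ordinal (block_lt lt_q lt_r)), (Ordinal (block_lt lt_q lt_s)).
split; rewrite ?ltn_add2l // ?block_sum_at ?ltn_add2l //.
apply/permP => p; apply: val_inj; rewrite permM /= block_sumE //.
have [lt_p lt_t] := (block_index_lt p, block_offset_lt p).
case: tpermP => [->|->|].
- by rewrite block_sum_at //= block_div ?block_mod // /update eqxx aE
    (nth_map 0) ?size_iota // nth_iota // add0n eqxx.
- rewrite block_sum_at //= block_div ?block_mod // /update eqxx aE.
  by rewrite (nth_map 0) ?size_iota // nth_iota // add0n eqxx (gtn_eqF lt_rs).
move=> /eqP; rewrite -val_eqE /= => p_r /eqP; rewrite -val_eqE /= => p_s.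
rewrite block_sumE //; congr (_ + _); rewrite /update; case: eqP => // pq.
rewrite aE (nth_map 0) ?size_iota // nth_iota // add0n pq.
have /negPf -> : p %% m != r by apply: contra p_r => /eqP <-; rewrite -pq -divn_eq.
have /negPf -> // : p %% m != s by apply: contra p_s => /eqP <-; rewrite -pq -divn_eq.
Qed.

(** The entries of F beyond the k-th one are set to a so that F stays in a
    prescribed set of words. *)
Lemma block_sum_of (z : 'S_(k * m)) a : word m a ->
  (forall p, z p %/ m = p %/ m) -> exists F,
  [/\ forall q, word m (F q), z = block_sum F & forall q, k <= q -> F q = a].
Proof.
move=> wa zq.
pose z' (p : nat) : nat := oapp (fun p : 'I_(k * m) => val (z p)) 0 (insub p).
pose F q := if q < k then mkseq (fun r => z' (q * m + r) %% m) m else a.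
have z'E (p : nat) (lt_p : p < k * m) : z' p = z (Ordinal lt_p) by rewrite /z' insubT.
have wF q : word m (F q).
  rewrite /F; case: ifP => // lt_q.
  have uF : uniq (mkseq (fun r => z' (q * m + r) %% m) m).
    apply/mkseq_uniqP => r s; rewrite !inE => r_m s_m.
    rewrite (z'E _ (block_lt lt_q r_m)) (z'E _ (block_lt lt_q s_m)) => eq_mod.
    have /perm_inj/(congr1 val)/= : z (Ordinal (block_lt lt_q r_m)) = z (Ordinal (block_lt lt_q s_m)).
      apply: val_inj; rewrite /= [LHS](divn_eq _ m) [RHS](divn_eq _ m) eq_mod.
      by rewrite !zq /= !block_div.
    by move/addnI.
  have sF : {subset mkseq (fun r => z' (q * m + r) %% m) m <= iota 0 m}.
    by move=> x /mapP[r]; rewrite !mem_iota /= => lt_r ->; rewrite ltn_mod; lia.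
  apply: uniq_perm => //; first exact: iota_uniq.
  by apply: (uniq_min_size uF sF _).2; rewrite size_iota size_mkseq.
exists F; split=> // [|q]; last by rewrite /F ltnNge => ->.
apply/permP => p; apply: val_inj; rewrite /= block_sumE //.
rewrite [LHS](divn_eq _ m) zq; congr (_ + _).
rewrite /F block_index_lt nth_mkseq ?block_offset_lt // -divn_eq.
by rewrite (z'E _ (ltn_ord p)); congr (val (z _) %% m); apply: val_inj.
Qed.

(** Below a block permutation, the two off-diagonal corners at a block boundary
    stay empty, since the number of entries in each of them increases along
    Bruhat order. *)
Lemma bruhat_block z G p : (forall q, word m (G q)) ->
  bruhat z (block_sum G) -> z p %/ m = p %/ m.
Proof.
move=> wG zG.
pose up (X p P : nat) : nat := (p < X * m) && (X * m <= P).
pose down (X p P : nat) : nat := (X * m <= p) && (P < X * m).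
have up_exch X : exchange_increasing (up X) by move=> a b c d; rewrite /up; lia.
have down_exch X : exchange_increasing (down X) by move=> a b c d; rewrite /down; lia.
have Gdiv p' : block_sum G p' %/ m = p' %/ m.
  by rewrite block_sumE // block_div // word_lt ?block_offset_lt.
have m_gt0 := block_size_gt0 p.
have zero f : exchange_increasing f ->
    (forall p' : 'I_(k * m), f p' (block_sum G p') = 0) -> f p (z p) = 0.
  move=> f_exch G0; have := bruhat_statistic f_exch zG.
  rewrite {2}/statistic big1 // leqn0 sum_nat_eq0 => /forallP/(_ p) /= H; exact/eqP.
apply/eqP; rewrite eqn_leq -ltnS ltn_divLR // ltnNge leq_divRL //; apply/andP; split.
  apply/negP => le_z; suff G0 p' : up (p %/ m).+1 p' (block_sum G p') = 0.
    by have := zero _ (up_exch _) G0; rewrite /up le_z ltn_ceil.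
  by rewrite /up -leq_divRL // -ltn_divLR // Gdiv; lia.
rewrite leqNgt; apply/negP => lt_z; suff G0 p' : down (p %/ m) p' (block_sum G p') = 0.
  by have := zero _ (down_exch _) G0; rewrite /down lt_z leq_trunc_div.
by rewrite /down -leq_divRL // -ltn_divLR // Gdiv; lia.
Qed.

End BlockSum.

(** * Bruhat intervals of block sums *)
Section BlockInterval.
Variables (m : nat) (v w : seq nat).

Definition interval_words : seq (seq nat) :=
  [seq a <- permutations (iota 0 m) | word_le m v a && word_le m a w].

(** Within L, the rank criterion is sufficient: from a one can step up to
    another word of L that still lies below b. The list is an argument, here
    and in the other tests, so that evaluation computes it only once. *)
Definition chained (L : seq (seq nat)) : bool :=
  all (fun a => all (fun b => word_le m a b ==>
    ((a == b) || has (fun c => word_step m a c && word_le m c b) L)) L) L.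

Lemma mem_interval_words a :
  (a \in interval_words) = [&& word m a, word_le m v a & word_le m a w].
Proof. by rewrite mem_filter mem_permutations andbC. Qed.

Variable k : nat.
Implicit Types F G : nat -> seq nat.
Let L := interval_words.
Let V : 'S_(k * m) := block_sum k m (fun=> v).
Let W : 'S_(k * m) := block_sum k m (fun=> w).
Hypothesis L_chained : chained L.
Hypothesis vL : v \in L.
Hypothesis wL : w \in L.

Lemma interval_word F : (forall q, F q \in L) -> forall q, word m (F q).
Proof. by move=> FL q; have := FL q; rewrite mem_interval_words => /and3P[]. Qed.

(** Climbs from F to G by changing one block at a time; lengths increase
    strictly, which bounds the number of steps. *)
Lemma bruhat_block_sum F G : (forall q, F q \in L) -> (forall q, G q \in L) ->
  (forall q, q < k -> word_le m (F q) (G q)) ->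
  bruhat (block_sum k m F) (block_sum k m G).
Proof.
move=> FL GL.
have [d] := ubnP (\max_(u : 'S_(k * m)) perm_length u - perm_length (block_sum k m F)).
elim: d F FL => // d IHd F FL le_d leFG.
have [/forallP eqFG|/forallPn[q ne_q]] := boolP [forall q : 'I_k, F q == G q].
  rewrite (_ : block_sum k m F = block_sum k m G); first exact: connect0.
  by apply: eq_block_sum => q lt_q; apply/eqP/(eqFG (Ordinal lt_q)).
have /allP/(_ (F q) (FL q))/allP/(_ (G q) (GL q)) := L_chained.
rewrite leFG //= (negPf ne_q) /= => /hasP[c cL /andP[stepFc le_cG]].
have step := bruhat_step_update (interval_word FL) (interval_word (fun=> cL) 0)
  (ltn_ord q) stepFc.
apply: connect_trans (connect1 step) _; apply: IHd.
- by move=> q'; rewrite /update; case: ifP.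
- have /andP[_ lt_len] := step.
  rewrite -ltnS; apply: leq_trans _ le_d; rewrite ltnS; apply: ltn_sub2l => //.
  by apply: leq_trans lt_len _; apply: (leq_bigmax (F := @perm_length _)).
- by move=> q' lt_q'; rewrite /update; case: eqP => [->|_] //; apply: leFG.
Qed.

Lemma block_interval z :
  z \in bruhat_interval V W <-> exists2 F, forall q, F q \in L & z = block_sum k m F.
Proof.
have cL a : a \in L -> forall q : nat, (fun=> a) q \in L by [].
rewrite inE; split=> [/andP[Vz zW]|[F FL ->]]; last first.
  have le_vw q : word_le m v (F q) && word_le m (F q) w.
    by have := FL q; rewrite mem_interval_words => /and3P[_ -> ->].
  by apply/andP; split; apply: bruhat_block_sum => // q _; case/andP: (le_vw q).
have wv := interval_word (cL _ vL); have ww := interval_word (cL _ wL).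
have [F [wF zE Fv]] := block_sum_of (wv 0) (fun p => bruhat_block p ww zW).
exists F => // q; have [lt_q|/Fv -> //] := ltnP q k; rewrite zE in Vz zW.
rewrite mem_interval_words wF (bruhat_word_le wv wF Vz lt_q).
by rewrite (bruhat_word_le wF ww zW lt_q).
Qed.

Lemma bruhat_block_ends : bruhat V W.
Proof.
apply: bruhat_block_sum => // q _.
by have := vL; rewrite mem_interval_words => /and3P[].
Qed.

Lemma perm_length_block_const a : word m a ->
  2 * perm_length (block_sum k m (fun=> a)) = k * word_discord m a.
Proof.
by move=> wa; rewrite perm_length_block_sum // sum_nat_const card_ord.
Qed.

End BlockInterval.

(** * Polytopes of block sums *)
Section BlockPolytope.
Local Open Scope classical_set_scope.
Local Open Scope ring_scope.
Variables (R : realType) (m : nat) (v w : seq nat) (k : nat).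
Implicit Types F G : nat -> seq nat.
Let L := interval_words m v w.
Let bsum F : 'S_(k * m) := block_sum k m F.
Let V := bsum (fun=> v).
Let W := bsum (fun=> w).
Hypothesis L_chained : chained m L.
Hypothesis vL : v \in L.
Hypothesis wL : w \in L.
Let P := bip R V W.

(** Linear forms on a block have natural coefficients: all words have the same
    sum, so a constant can be added to a form without changing its
    differences. *)
Definition dot (c a : seq nat) : nat :=
  sumn [seq (entry c r * entry a r)%N | r <- index_iota 0 m].

Lemma dot_nil a : dot [::] a = 0%N.
Proof. by rewrite /dot sumnE big_map big1 // => r _; rewrite nth_nil. Qed.

Lemma dot_ones a : word m a -> dot (nseq m 1%N) a = \sum_(0 <= r < m) r.
Proof.
move=> wa; rewrite /dot sumnE big_map.
transitivity (\sum_(r <- a) r); last by rewrite (perm_big _ wa) /index_iota subn0.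
rewrite [RHS](big_nth 0%N) (word_size wa) !big_nat; apply: eq_bigr => r /andP[_ r_m].
by rewrite nth_nseq r_m mul1n.
Qed.

Definition block_col (g : nat -> seq nat) : 'cV[R]_(k * m) :=
  \col_p (entry (g (p %/ m)%N) (p %% m)%N)%:R.

Lemma perm_point_subE F G p : (forall q, word m (F q)) -> (forall q, word m (G q)) ->
  (perm_point R (bsum F) - perm_point R (bsum G)) 0 p =
  (entry (F (p %/ m)%N) (p %% m)%N)%:R - (entry (G (p %/ m)%N) (p %% m)%N)%:R.
Proof.
move=> wF wG; rewrite !mxE !block_sumE // -!addnS !natrD.
by rewrite -!natr1; ring.
Qed.

Lemma block_col_sub F G g : (forall q, word m (F q)) -> (forall q, word m (G q)) ->
  ((perm_point R (bsum F) - perm_point R (bsum G)) *m block_col g) 0 0 =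
  \sum_(q < k) ((dot (g q) (F q))%:R - (dot (g q) (G q))%:R).
Proof.
move=> wF wG; rewrite mxE.
pose f p : R := ((entry (F (p %/ m)%N) (p %% m)%N)%:R - (entry (G (p %/ m)%N) (p %% m)%N)%:R)
  * (entry (g (p %/ m)%N) (p %% m)%N)%:R.
transitivity (\sum_(p < k * m) f p).
  by apply: eq_bigr => p _; rewrite perm_point_subE // mxE.
rewrite (sum_blocks _ _ _ f); apply: eq_bigr => q _.
rewrite /dot !sumnE !big_map !natr_sum -sumrB; apply: eq_big_nat => r /andP[_ r_m].
by rewrite /f !block_div // !block_mod // !natrM mulrBl; congr (_ - _); rewrite mulrC.
Qed.

Lemma perm_point_inj n : injective (@perm_point R n).
Proof.
move=> u u' /rowP eq_uu'; apply/permP => i; apply: val_inj.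
by have /eqP := eq_uu' i; rewrite !mxE eqr_nat eqSS => /eqP.
Qed.

Definition exposes (L : seq (seq nat)) x (S : seq (seq nat)) c : bool :=
  all (fun a => (dot c a <= dot c x)%N && ((dot c a == dot c x) == (a \in S))) L.

(** A form on the sum splits into forms on the blocks, and it attains its
    maximum exactly where all of them do. *)
Lemma block_exposes x (S : nat -> seq (seq nat)) g F :
  word m x -> (forall q, exposes L x (S q) (g q)) -> (forall q, F q \in L) ->
  ((perm_point R (bsum F) - perm_point R (bsum (fun=> x))) *m block_col g) 0 0 <= 0
  /\ (((perm_point R (bsum F) - perm_point R (bsum (fun=> x))) *m block_col g) 0 0 = 0 <->
      forall q, (q < k)%N -> F q \in S q).
Proof.
move=> wx sepS FL; rewrite (block_col_sub _ (interval_word FL)) //.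
have sep q : (dot (g q) (F q) <= dot (g q) x)%N /\
    ((dot (g q) (F q) == dot (g q) x) = (F q \in S q)).
  by have /allP/(_ (F q) (FL q))/andP[-> /eqP ->] := sepS q.
have le0 q : (dot (g q) (F q))%:R - (dot (g q) x)%:R <= 0 :> R.
  by rewrite subr_le0 ler_nat (sep q).1.
split; first by apply: sumr_le0.
split=> [sum0 q lt_q|FS].
  have /eqP := nonpos_sum_eq0 (fun q : 'I_k => le0 q) sum0 (Ordinal lt_q).
  by rewrite subr_eq0 eqr_nat (sep q).2.
rewrite big1 // => q _; apply/eqP; rewrite subr_eq0 eqr_nat (sep q).2; exact: FS.
Qed.

Section Dimension.
Variable B : seq (seq nat * seq nat).

(** Each word of B comes with a form that detects its displacement from v and
    ignores that of the other words, which makes the displacements linearly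
    independent. *)
Definition independent (L : seq (seq nat)) : bool :=
  all (fun b => b.1 \in L) B &&
  all (fun i => all (fun j =>
     (dot (nth ([::], [::]) B i).2 (nth ([::], [::]) B j).1 != dot (nth ([::], [::]) B i).2 v) == (i == j))
     (iota 0 (size B))) (iota 0 (size B)).

Lemma affine_dim_block_ge : independent L -> (k * size B <= affine_dim P)%N.
Proof.
move=> /andP[BL Bind]; set e := size B.
pose b j := nth ([::], [::]) B j.
have bL j : (j < e)%N -> (b j).1 \in L by move=> lt_j; apply: (allP BL); apply: mem_nth.
have off_lt (i : 'I_(k * e)) : (i %% e < e)%N by apply: block_offset_lt.
pose Fi (i : 'I_(k * e)) := update (fun=> v) (i %/ e)%N (b (i %% e)%N).1.
have FiL i q : Fi i q \in L by rewrite /Fi /update; case: ifP => // _; apply: bL.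
have wFi i := interval_word (FiL i).
have wv : forall q : nat, word m ((fun=> v) q) := interval_word (fun=> vL).
pose D : 'M[R]_(k * e, k * m) := \matrix_(i, p) (perm_point R (bsum (Fi i)) - perm_point R V) 0 p.
have rowD i : row i D = perm_point R (bsum (Fi i)) - perm_point R V.
  by apply/rowP => p; rewrite !mxE.
have PF F : (forall q, F q \in L) -> P (perm_point R (bsum F)).
  by move=> FL; apply: hull_pt; apply/block_interval => //; exists F.
apply: (@affine_dim_ge _ _ _ _ (perm_point R V) D).
- exact: PF.
- by move=> i; rewrite rowD addrC subrK; apply: PF.
apply: inj_row_free => u uD; apply/rowP => i; rewrite mxE.
pose g q := if q == (i %/ e)%N then (b (i %% e)%N).2 else [::].
have := congr1 (fun x => (x *m block_col g) 0 0) uD; rewrite mul0mx [RHS]mxE.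
rewrite (mulmx_sum_row u) mulmx_suml summxE (bigD1 i) //= [X in _ + X]big1 ?addr0.
  rewrite -scalemxAl mxE rowD (block_col_sub _ (wFi _) wv).
  move/eqP; rewrite mulf_eq0 => /orP[/eqP //|].
  rewrite (bigD1 (Ordinal (block_index_lt i))) //= [X in _ + X]big1 ?addr0.
    rewrite /g /Fi /update eqxx subr_eq0 eqr_nat.
    have /allP/(_ (i %% e)%N) := Bind; rewrite mem_iota add0n off_lt => /(_ isT).
    move=> /allP/(_ (i %% e)%N); rewrite mem_iota add0n off_lt => /(_ isT).
    by rewrite eqxx => /eqP/negPf ->.
  by move=> q ne; rewrite /Fi /update -val_eqE in ne *; rewrite (negPf ne) subrr.
move=> j ne_ij; rewrite -scalemxAl mxE rowD (block_col_sub _ (wFi _) wv).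
rewrite big1 ?mulr0 // => q _; rewrite /g /Fi /update.
have [q_i|_] := eqVneq (q : nat) (i %/ e)%N; last first.
  by rewrite !dot_nil subrr.
have [q_j|_] := eqVneq (q : nat) (j %/ e)%N; last by rewrite subrr.
apply/eqP; rewrite subr_eq0 eqr_nat.
have /allP/(_ (i %% e)%N) := Bind; rewrite mem_iota add0n off_lt => /(_ isT).
move=> /allP/(_ (j %% e)%N); rewrite mem_iota add0n off_lt => /(_ isT).
have /negPf -> : (i %% e != j %% e)%N.
  apply: contra ne_ij => /eqP eq_mod; apply/eqP/val_inj.
  by rewrite /= (divn_eq i e) (divn_eq j e) -q_i -q_j eq_mod.
by rewrite eqbF_neg negbK.
Qed.

End Dimension.

(** The sum of the coordinates in each block is constant, which gives k
    independent equations. *)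
Lemma affine_dim_block_le : (0 < m)%N -> (affine_dim P <= k * m.-1)%N.
Proof.
move=> m_gt0.
pose g (q : nat) q' := if q' == q then nseq m 1%N else [::].
pose A : 'M[R]_(k * m, k) := \matrix_(p, q) block_col (g q) p 0.
have rankA : \rank A = k.
  apply/eqP; rewrite eqn_leq rank_leq_col /=.
  have q0_lt (q : 'I_k) : (q * m < k * m)%N by rewrite ltn_pmul2r.
  pose C : 'M[R]_(k, k * m) := \matrix_(q, p) (p == Ordinal (q0_lt q))%:R.
  suff rankCA : \rank (C *m A) = k by rewrite -[leqLHS]rankCA mxrankM_maxr.
  rewrite (_ : C *m A = 1%:M) ?mxrank1 //; apply/matrixP => q q'.
  rewrite mxE (bigD1 (Ordinal (q0_lt q))) //= big1 ?addr0 => [|p /negPf ne]; last first.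
    by rewrite mxE ne mul0r.
  rewrite !mxE eqxx mul1r /= mulnK // modnMl /g val_eqE.
  by case: eqP => _; rewrite ?nth_nil ?nth_nseq ?m_gt0.
apply: leq_trans (_ : (\rank (kermx A) <= _)%N); last first.
  by rewrite mxrank_ker rankA -subn1 mulnBr muln1.
apply: (@affine_dim_le _ _ _ (perm_point R V)) => p Pp; apply: hull_sub Pp => z.
move=> /block_interval[] // F FL ->; apply/sub_kermxP/rowP => q.
rewrite [RHS]mxE.
transitivity (((perm_point R (bsum F) - perm_point R V) *m block_col (g q)) 0 0).
  by rewrite !mxE; apply: eq_bigr => p' _; rewrite !mxE.
rewrite block_col_sub; [|exact: interval_word|exact: (interval_word (fun=> vL))].
rewrite big1 // => q' _; rewrite /g; case: eqP => _.
  rewrite !dot_ones ?subrr //; last exact: interval_word FL _.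
  exact: interval_word (fun=> vL) 0%N.
by rewrite !dot_nil subrr.
Qed.

Section Degree.
Variables (x s : seq nat) (E : seq (seq nat * seq nat)).

(** The pairs in E are the neighbours of x, each with a form that exposes the
    edge from x to it; s exposes x alone, and serves in the blocks in which an
    edge of the sum stays at x. *)
Definition edges_exposed (L : seq (seq nat)) : bool :=
  [&& exposes L x [:: x] s, uniq (map fst E) &
   all (fun e => [&& e.1 \in L, e.1 != x & exposes L x [:: x; e.1] e.2]) E].

(** The displacement a - b is a positive multiple of y - x. As s is a linear
    form, comparing its values gives the ratio g / h, and clearing the
    denominator leaves an equation between natural numbers. *)
Definition descends a b y : bool :=
  let g := (dot s b - dot s a)%N in let h := (dot s x - dot s y)%N in
  [&& (0 < g)%N, (0 < h)%N &
   all (fun r => h * entry a r + g * entry x r == h * entry b r + g * entry y r)%N (iota 0 m)].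

(** A local form of the cone condition: from every word one reaches x by
    successive moves along directions of edges at x. *)
Definition edges_span (L : seq (seq nat)) : bool :=
  all (fun a => (a == x) || has (fun b => has (fun e => descends a b e.1) E) L) L.

Let edge i := nth ([::], [::]) E i.

(** The moves add up; they terminate because each one increases s, which is
    maximal at x. *)
Lemma edges_cone : exposes L x [:: x] s -> edges_span L -> forall a, a \in L ->
  exists f : 'I_(size E) -> R, (forall i, 0 <= f i) /\
  forall r, (r < m)%N -> (entry a r)%:R - (entry x r)%:R =
    \sum_i f i * ((entry (edge i).1 r)%:R - (entry x r)%:R).
Proof.
move=> /allP sep_s span a; have [d] := ubnP (dot s x - dot s a)%N.
elim: d a => // d IHd a le_d aL; have /allP/(_ a aL)/orP[/eqP ->|] := span.
  exists (fun=> 0); split=> // r _; rewrite subrr big1 // => i _; exact: mul0r.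
move=> /hasP[b bL /hasP[e eE /and3P[g_gt0 h_gt0 /allP root]]].
have [|f [f0 fE]] := IHd b _ bL; first by have /andP[+ _] := sep_s b bL; move: g_gt0 le_d; lia.
set g := (dot s b - dot s a)%N in g_gt0 root *.
set h := (dot s x - dot s e.1)%N in h_gt0 root *.
have lt_e : (index e E < size E)%N by rewrite index_mem.
pose j := Ordinal lt_e; have eE' : edge j = e by rewrite /edge nth_index.
exists (fun i => f i + (i == j)%:R * (g%:R / h%:R)); split=> [i|r r_m].
  by rewrite addr_ge0 // mulr_ge0 ?divr_ge0 ?ler0n.
under eq_bigr do rewrite mulrDl; rewrite big_split /= -fE //.
rewrite [X in _ = _ + X](bigD1 j) //= [X in _ = _ + (_ + X)]big1 => [|i /negPf ->]; last by rewrite !mul0r.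
rewrite eqxx mul1r addr0 eE'.
have := root r; rewrite mem_iota add0n r_m => /(_ isT) /eqP/(congr1 (fun i : nat => i%:R : R)).
rewrite !natrD !natrM => eq_r.
have h0 : h%:R != 0 :> R by rewrite pnatr_eq0 -lt0n.
apply: (mulfI h0); rewrite [RHS]mulrDr [h%:R * (_ / _ * _)]mulrA [h%:R * (_ / _)]mulrC divfK //.
by rewrite !mulrBr; lra.
Qed.

(** The neighbours of the constant sum are obtained by moving a single block
    along one of its edges. *)
Lemma edge_degree_block : edges_exposed L -> edges_span L ->
  word m x -> x \in L -> bip_degree R V W (bsum (fun=> x)) = (k * size E)%N.
Proof.
move=> /and3P[sep_s uniqE /allP sepE] span wx xL.
pose X := bsum (fun=> x).
have wX : forall q : nat, word m ((fun=> x) q) by [].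
have edgeP (i : 'I_(size E)) :
    [/\ (edge i).1 \in L, (edge i).1 != x & exposes L x [:: x; (edge i).1] (edge i).2].
  by have /and3P := sepE _ (mem_nth ([::], [::]) (ltn_ord i)).
pose YF (qi : 'I_k * 'I_(size E)) := update (fun=> x) qi.1 (edge qi.2).1.
have YL qi q : YF qi q \in L by rewrite /YF /update; case: ifP => // _; have [] := edgeP qi.2.
have wY qi := interval_word (YL qi).
pose y qi := bsum (YF qi).
pose g (qi : 'I_k * 'I_(size E)) := update (fun=> s) qi.1 (edge qi.2).2.
pose S (qi : 'I_k * 'I_(size E)) := update (fun=> [:: x]) qi.1 [:: x; (edge qi.2).1].
have sep qi q : exposes L x (S qi q) (g qi q).
  by rewrite /S /g /update; case: ifP => // _; have [] := edgeP qi.2.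
have y_inj : injective y.
  move=> [q i] [q' i'] /(block_sum_inj (wY _) (wY _))/(_ q (ltn_ord q)).
  rewrite /YF /update /= eqxx; case: eqP => [/val_inj ->|_ eq_x]; last first.
    by have [_] := edgeP i; rewrite eq_x eqxx.
  move=> eq_e; congr (_, _); apply: val_inj; apply/eqP.
  rewrite -(nth_uniq [::] _ _ uniqE) ?size_map ?ltn_ord //.
  by rewrite !(nth_map ([::], [::])) ?ltn_ord //; apply/eqP/eq_e.
have y_neq qi : y qi != X.
  apply/eqP => /(block_sum_inj (wY _) wX)/(_ qi.1 (ltn_ord _)).
  by rewrite /YF /update eqxx; have [_ /eqP] := edgeP qi.2.
transitivity #|{: 'I_k * 'I_(size E)}|; last by rewrite card_prod !card_ord.
apply: (@edge_degree_hull _ _ _ _ _ X _ y (fun qi => block_col (g qi))).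
- by apply/block_interval => //; exists (fun=> x).
- by move=> qi; apply/block_interval => //; exists (YF qi).
- exact: y_inj.
- by move=> qi; rewrite (inj_eq (@perm_point_inj _)).
- move=> qi z /block_interval[] // F FL ->.
  by have [] := block_exposes wx (sep qi) FL.
- move=> qi z /block_interval[] // F FL ->.
  have [_ ->] := block_exposes wx (sep qi) FL; split=> [FS|[] eq_z].
  + have Fx q : (q < k)%N -> q != qi.1 -> F q = x.
      by move=> lt_q /negPf ne; have := FS q lt_q; rewrite /S /update ne inE => /eqP.
    have := FS _ (ltn_ord qi.1); rewrite /S /update eqxx !inE => /orP[]/eqP Fq; [left|right].
      by apply: eq_block_sum => q /Fx; case: eqP => [-> _|_ ->].
    apply: eq_block_sum => q /Fx; rewrite /YF /update.
    by case: eqP => [-> _|_ ->].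
  + move=> q lt_q; rewrite (block_sum_inj (interval_word FL) wX eq_z) //.
    by rewrite /S /update; case: ifP; rewrite !inE eqxx.
  + move=> q lt_q; rewrite (block_sum_inj (interval_word FL) (wY qi) eq_z) //.
    by rewrite /S /YF /update; case: ifP; rewrite !inE eqxx ?orbT.
move=> z /block_interval[] // F FL ->.
have /fin_all_exists[f fE] : forall q : 'I_k, exists f : 'I_(size E) -> R,
    (forall i, 0 <= f i) /\
    forall r, (r < m)%N -> (entry (F q) r)%:R - (entry x r)%:R =
      \sum_i f i * ((entry (edge i).1 r)%:R - (entry x r)%:R).
  by move=> q; apply: edges_cone (FL q).
exists (fun qi => f qi.1 qi.2); split=> [qi|]; first exact: (fE qi.1).1.
apply/rowP => p; rewrite perm_point_subE //; last exact: interval_word.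
rewrite summxE -(pair_bigA _ (fun q i => (f q i *: (perm_point R (y (q, i)) - perm_point R X)) 0 p)) /=.
rewrite (bigD1 (Ordinal (block_index_lt p))) //= [X in _ = _ + X]big1 ?addr0.
  have [_ ->] := fE (Ordinal (block_index_lt p)); last exact: block_offset_lt.
  by apply: eq_bigr => i _; rewrite [RHS]mxE perm_point_subE // /YF /update /= eqxx.
move=> q /negPf ne; rewrite big1 // => i _; rewrite mxE perm_point_subE //.
have ne' : (p %/ m == q)%N = false by rewrite eq_sym; apply: ne.
by rewrite /YF /update /= ne' subrr mulr0.
Qed.

End Degree.

End BlockPolytope.

(** * Boolean intervals of block sums *)
Fixpoint bitseqs l : seq bitseq :=
  if l is l'.+1 then [seq true :: s | s <- bitseqs l'] ++ [seq false :: s | s <- bitseqs l']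
  else [:: [::]].

Lemma mem_bitseqs s : s \in bitseqs (size s).
Proof. by elim: s => // -[] s IHs; rewrite mem_cat !map_f ?orbT. Qed.

Section Boolean.
Variables (m : nat) (v w : seq nat) (k : nat) (atoms : seq (seq nat)).
Let L := interval_words m v w.
Let t := size atoms.

(** In a Boolean algebra an element is determined by the atoms below it. *)
Definition bits a : bitseq := [seq word_le m b a | b <- atoms].
Definition word_of_bits (M : seq (seq nat)) (s : bitseq) := nth [::] M (index s (map bits M)).

Definition boolean_words (M : seq (seq nat)) : bool :=
  [&& all (fun s => s \in map bits M) (bitseqs (size atoms)),
      all (fun a => word_of_bits M (bits a) == a) M &
      all (fun a => all (fun b => word_le m a b ==
        all (fun r => nth false (bits a) r ==> nth false (bits b) r) (iota 0 (size atoms))) M) M].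

Hypothesis L_chained : chained m L.
Hypothesis vL : v \in L.
Hypothesis wL : w \in L.
Hypothesis L_boolean : boolean_words L.

Let bit (X : {set 'I_k * 'I_t}) (q r : nat) : bool :=
  [exists y in X, (y.1 == q :> nat) && (y.2 == r :> nat)].

Let subset_words X q := word_of_bits L (mkseq (bit X q) t).

Lemma bits_mkseq X q : mkseq (bit X q) t \in map bits L.
Proof.
have /and3P[/allP surj _ _] := L_boolean.
by apply: surj; rewrite -/t -{2}(size_mkseq (bit X q) t) mem_bitseqs.
Qed.

Lemma subset_words_mem X q : subset_words X q \in L.
Proof.
by rewrite /subset_words /word_of_bits mem_nth // -(size_map bits) index_mem bits_mkseq.
Qed.

Lemma bits_subset_words X q : bits (subset_words X q) = mkseq (bit X q) t.
Proof.
rewrite /subset_words /word_of_bits -(nth_map _ (bits [::])) ?nth_index ?bits_mkseq //.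
by rewrite -(size_map bits) index_mem bits_mkseq.
Qed.

Lemma bitE X (q : 'I_k) (r : 'I_t) : bit X q r = ((q, r) \in X).
Proof.
apply/existsP/idP => [[[q' r'] /and3P[yX /eqP/val_inj <- /eqP/val_inj <-]] //|qrX].
by exists (q, r); rewrite qrX !eqxx.
Qed.

(** The atoms of the k-th power are the pairs of a block and an atom of that
    block. *)
Lemma boolean_algebra_block :
  boolean_algebra (@bruhat (k * m))
    (bruhat_interval (block_sum k m (fun=> v)) (block_sum k m (fun=> w))).
Proof.
have /and3P[_ /allP bitsK /allP le_bits] := L_boolean.
have leE a b : a \in L -> b \in L -> word_le m a b =
    all (fun r => nth false (bits a) r ==> nth false (bits b) r) (iota 0 t).
  by move=> aL bL; have /allP/(_ b bL)/eqP := le_bits a aL.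
exists ('I_k * 'I_t)%type, (fun X => block_sum k m (subset_words X)); split.
  apply/setP => z; apply/imsetP/idP => [[X _ ->]|].
    by apply/block_interval => //; exists (subset_words X) => //; apply: subset_words_mem.
  move=> /block_interval[] // F FL ->.
  exists [set y : 'I_k * 'I_t | nth false (bits (F y.1)) y.2] => //; apply: eq_block_sum => q lt_q.
  rewrite -(eqP (bitsK _ (FL q))) /subset_words; congr word_of_bits.
  apply: (@eq_from_nth _ false); first by rewrite size_mkseq size_map.
  rewrite size_map => r lt_r; rewrite nth_mkseq //.
  by rewrite (bitE _ (Ordinal lt_q) (Ordinal lt_r)) inE.
move=> X Y; apply/idP/idP => [le_XY|/fintype.subsetP sub_XY].
  apply/fintype.subsetP => -[q r]; rewrite -!bitE.
  have := bruhat_word_le (interval_word (subset_words_mem X)) (interval_word (subset_words_mem Y)) le_XY (ltn_ord q).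
  rewrite leE ?subset_words_mem // => /allP/(_ r); rewrite mem_iota !bits_subset_words !nth_mkseq //.
  by move=> /(_ (ltn_ord r))/implyP.
apply: (bruhat_block_sum L_chained (subset_words_mem X) (subset_words_mem Y)) => q lt_q.
rewrite leE ?subset_words_mem //; apply/allP => r; rewrite mem_iota => lt_r.
rewrite !bits_subset_words !nth_mkseq //; apply/implyP.
rewrite (bitE _ (Ordinal lt_q) (Ordinal lt_r)) (bitE _ (Ordinal lt_q) (Ordinal lt_r)).
exact: sub_XY.
Qed.

End Boolean.

(** * The three blocks *)

(* The names are in one-line notation on {1, ..., m}, the words start from 0. *)
Definition p1324 := [:: 0; 2; 1; 3].
Definition p4231 := [:: 3; 1; 2; 0].
Definition p3412 := [:: 2; 3; 0; 1].
Definition p13254 := [:: 0; 2; 1; 4; 3].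
Definition p35142 := [:: 2; 4; 0; 3; 1].

(** Exchanges of two positions whose position pairs form a spanning tree; the
    form attached to an exchange is the indicator of one of the two components
    left by removing its edge from the tree. *)
Definition tree_1324 :=
  [:: ([:: 2; 0; 1; 3], [:: 1; 0; 1; 0]); ([:: 1; 2; 0; 3], [:: 0; 0; 1; 0]);
      ([:: 0; 3; 1; 2], [:: 0; 0; 0; 1])].
Definition tree_13254 :=
  [:: ([:: 2; 0; 1; 4; 3], [:: 1; 0; 1; 0; 0]); ([:: 1; 2; 0; 4; 3], [:: 0; 0; 1; 0; 0]);
      ([:: 0; 4; 1; 2; 3], [:: 0; 0; 0; 1; 0]); ([:: 0; 3; 1; 4; 2], [:: 0; 0; 0; 0; 1])].

Definition atoms_1324 :=
  [:: [:: 2; 0; 1; 3]; [:: 1; 2; 0; 3]; [:: 0; 3; 1; 2]; [:: 0; 2; 3; 1]].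

Definition edges_at_1324 :=
  [:: ([:: 0; 2; 3; 1], [:: 0; 1; 2; 2]); ([:: 0; 3; 1; 2], [:: 0; 2; 1; 2]);
      ([:: 1; 2; 0; 3], [:: 0; 1; 0; 2]); ([:: 2; 0; 1; 3], [:: 0; 0; 1; 2])].
Definition edges_at_3412 :=
  [:: ([:: 0; 3; 2; 1], [:: 1; 2; 1; 0]); ([:: 1; 3; 0; 2], [:: 1; 2; 0; 1]);
      ([:: 2; 0; 3; 1], [:: 2; 1; 1; 0]); ([:: 2; 1; 0; 3], [:: 2; 1; 0; 1])].
Definition edges_at_13254 :=
  [:: ([:: 0; 2; 3; 4; 1], [:: 0; 1; 2; 3; 2]); ([:: 0; 2; 4; 1; 3], [:: 0; 1; 2; 2; 3]);
      ([:: 0; 3; 1; 4; 2], [:: 0; 2; 1; 3; 2]); ([:: 0; 4; 1; 2; 3], [:: 0; 2; 1; 2; 3]);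
      ([:: 1; 2; 0; 4; 3], [:: 0; 1; 0; 2; 2]); ([:: 2; 0; 1; 4; 3], [:: 0; 0; 1; 2; 2])].
Definition edges_at_35142 :=
  [:: ([:: 0; 4; 2; 3; 1], [:: 1; 2; 1; 1; 0]); ([:: 1; 4; 0; 3; 2], [:: 1; 3; 0; 2; 1]);
      ([:: 2; 0; 4; 3; 1], [:: 3; 2; 2; 1; 0]); ([:: 2; 3; 0; 4; 1], [:: 1; 1; 0; 1; 0]);
      ([:: 2; 4; 0; 1; 3], [:: 1; 1; 0; 0; 0])].

Definition block_ok m v w (basis : seq (seq nat * seq nat)) :=
  (fun L => [&& chained m L, v \in L, w \in L, independent m v basis L & size basis == m.-1])
  (interval_words m v w).

Definition degree_ok m v w x s E :=
  (fun L => edges_exposed m x s E L && edges_span m x s E L) (interval_words m v w).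

Lemma block_ok_1324_4231 : block_ok 4 p1324 p4231 tree_1324. Proof. by vm_compute. Qed.
Lemma boolean_1324_4231 : (fun M => boolean_words 4 atoms_1324 M) (interval_words 4 p1324 p4231).
Proof. by vm_compute. Qed.
Lemma block_ok_1324_3412 : block_ok 4 p1324 p3412 tree_1324. Proof. by vm_compute. Qed.
Lemma block_ok_13254_35142 : block_ok 5 p13254 p35142 tree_13254. Proof. by vm_compute. Qed.
Lemma degree_ok_1324 : degree_ok 4 p1324 p3412 p1324 [:: 0; 1; 1; 2] edges_at_1324. Proof. by vm_compute. Qed.
Lemma degree_ok_3412 : degree_ok 4 p1324 p3412 p3412 [:: 1; 1; 0; 0] edges_at_3412. Proof. by vm_compute. Qed.
Lemma degree_ok_13254 : degree_ok 5 p13254 p35142 p13254 [:: 0; 1; 1; 2; 2] edges_at_13254. Proof. by vm_compute. Qed.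
Lemma degree_ok_35142 : degree_ok 5 p13254 p35142 p35142 [:: 1; 2; 0; 1; 0] edges_at_35142. Proof. by vm_compute. Qed.

Section Summary.
Local Open Scope ring_scope.
Variables (R : realType) (m : nat) (v w : seq nat) (basis : seq (seq nat * seq nat)).
Hypothesis ok : block_ok m v w basis.
Variable k : nat.
Let V := block_sum k m (fun=> v).
Let W := block_sum k m (fun=> w).

Lemma block_bruhat : bruhat V W.
Proof. by have /and5P[ch vL wL _ _] := ok; apply: bruhat_block_ends. Qed.

Lemma block_affine_dim : (0 < m)%N -> affine_dim (bip R V W) = (k * m.-1)%N.
Proof.
have /and5P[ch vL wL ind /eqP sz] := ok => m_gt0; apply/eqP; rewrite eqn_leq.
by rewrite affine_dim_block_le //= -sz (affine_dim_block_ge _ _ ch vL wL ind).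
Qed.

Lemma block_length l : (word_discord m w = word_discord m v + 2 * l)%N ->
  (perm_length W = perm_length V + k * l)%N.
Proof.
have /and5P[_ vL wL _ _] := ok => eq_d.
have := perm_length_block_const k (interval_word (fun=> vL) 0%N).
have := perm_length_block_const k (interval_word (fun=> wL) 0%N).
by rewrite eq_d -/V -/W; nia.
Qed.

Lemma block_degree x s E : x \in interval_words m v w -> degree_ok m v w x s E ->
  bip_degree R V W (block_sum k m (fun=> x)) = (k * size E)%N.
Proof.
have /and5P[ch vL wL _ _] := ok => xL /andP[exposed span].
exact: edge_degree_block exposed span (interval_word (fun=> xL) 0%N) xL.
Qed.

End Summary.

Local Open Scope ring_scope.

Theorem proposition6p4 (R : realType) (k : nat) :
  [/\ exists (n : nat) (v w : 'S_n),
        [/\ bruhat v w,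
            boolean_algebra (@bruhat n) (bruhat_interval v w) &
            complexity R v w = k%:Z],
      exists (n : nat) (v w : 'S_n),
        [/\ bruhat v w,
            toric R v w,
            bip_degree R v w v = (affine_dim (bip R v w) + k)%N &
            bip_degree R v w w = (affine_dim (bip R v w) + k)%N] &
      exists (n : nat) (v w : 'S_n),
        [/\ bruhat v w,
            toric R v w &
            `|(bip_degree R v w v)%:Z - (bip_degree R v w w)%:Z| = k%:Z]].
Proof.
split.
- exists (k * 4)%N, (block_sum k 4 (fun=> p1324)), (block_sum k 4 (fun=> p4231)); split.
  + exact: block_bruhat block_ok_1324_4231 k.
  + have /and5P[ch vL wL _ _] := block_ok_1324_4231; exact: boolean_algebra_block ch vL wL boolean_1324_4231.
  + by rewrite /complexity (block_affine_dim _ block_ok_1324_4231) // (@block_length _ _ _ _ block_ok_1324_4231 k 4) //; lia.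
- exists (k * 4)%N, (block_sum k 4 (fun=> p1324)), (block_sum k 4 (fun=> p3412)).
  have /and5P[_ vL wL _ _] := block_ok_1324_3412; split.
  + exact: block_bruhat block_ok_1324_3412 k.
  + by rewrite /toric (block_affine_dim _ block_ok_1324_3412) // (@block_length _ _ _ _ block_ok_1324_3412 k 3) //; lia.
  + by rewrite (block_affine_dim _ block_ok_1324_3412) // (block_degree _ block_ok_1324_3412 _ vL degree_ok_1324) /=; lia.
  + by rewrite (block_affine_dim _ block_ok_1324_3412) // (block_degree _ block_ok_1324_3412 _ wL degree_ok_3412) /=; lia.
- exists (k * 5)%N, (block_sum k 5 (fun=> p13254)), (block_sum k 5 (fun=> p35142)).
  have /and5P[_ vL wL _ _] := block_ok_13254_35142; split.
  + exact: block_bruhat block_ok_13254_35142 k.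
  + by rewrite /toric (block_affine_dim _ block_ok_13254_35142) // (@block_length _ _ _ _ block_ok_13254_35142 k 4) //; lia.
  + rewrite (block_degree _ block_ok_13254_35142 _ vL degree_ok_13254) (block_degree _ block_ok_13254_35142 _ wL degree_ok_35142) /=.
    by lia.
Qed.
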